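(* Let $a$ and $i$ be positive integers. Then the polynomial $$P(q):=\binom{3a+i}{a+i}_q-\binom{3a+2i}{a}_q$$ has non-negative coefficients.
   Context: For nonnegative integers $n$, $[n]!_q=\prod_{j=1}^n\frac{1-q^j}{1-q}$ (with $[0]!_q=1$), and for integers $0\le k\le n$ the Gaussian polynomial (q-binomial coefficient) is $\binom{n}{k}_q=\frac{[n]!_q}{[k]!_q[n-k]!_q}$, a polynomial in $q$; set $\binom{n}{k}_q=0$ if $k<0$ or $k>n$. *)

(* Defs.v *)
From mathcomp Require Import all_boot all_order all_algebra.
Set Implicit Arguments. Unset Strict Implicit. Unset Printing Implicit Defensive.
Import Order.TTheory GRing.Theory Num.Theory.
Local Open Scope ring_scope.

Definition qint (j : nat) : {poly rat} := \sum_(k < j) 'X^k.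

Definition qfact (n : nat) : {poly rat} := \prod_(1 <= j < n.+1) qint j.

(* Gaussian polynomial: [n]!_q / ([k]!_q [n-k]!_q) for 0 <= k <= n, and 0 otherwise.
   The division is exact polynomial division in {poly rat}. *)
Definition qbinom (n k : nat) : {poly rat} :=
  if (k <= n)%N then qfact n %/ (qfact k * qfact (n - k)) else 0.

Definition nonneg_coeffs (p : {poly rat}) : Prop := forall i : nat, 0 <= p`_i.

(* Main.v *)
Require Import Defs.
From mathcomp Require Import all_boot all_order all_algebra.
From mathcomp Require Import zify ring.

(** Put [m = a + i], so that the claim compares [2a+m choose m]_q with
    [2m+a choose a]_q.  Both are complete homogeneous symmetric polynomials
    evaluated at [1, q, ..., q^(2a)], resp. [1, q, ..., q^(2m)].  Splitting the
    variables into even and odd powers of [q] writes both as sums of products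
    of two Gaussian polynomials in [Q = q^2].  After aligning the powers of [q]
    the sums compare term by term: with [a = j + s], one needs
    [m+j, j+s]_Q [j+2s-1, s]_Q >= [m+j, j]_Q [m+s-1, s]_Q coefficientwise.
    Expanding the second factors by q-Vandermonde over [s-1] extra elements,
    trinomial revision reduces this to [n, k]_Q >= [n, l]_Q for
    [l <= k <= n - l], the coefficientwise unimodality of Gaussian polynomials
    in the lower index. *)

Set Implicit Arguments.
Unset Strict Implicit.
Unset Printing Implicit Defensive.
Import Order.TTheory GRing.Theory Num.Theory.
Local Open Scope ring_scope.

(** * Gaussian polynomials and complete homogeneous sums *)

(** Division-free, by the q-Pascal rule, so that [q] can be specialised both to ['X] and to
    ['X ^+ 2]. *)
Fixpoint gauss (R : comNzRingType) (q : R) (n k : nat) : R :=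
  match n, k with
  | _, 0 => 1
  | 0, _.+1 => 0
  | n'.+1, k'.+1 => gauss q n' k' + q ^+ k'.+1 * gauss q n' k'.+1
  end.

Section GaussianPolynomials.
Variables (R : comNzRingType) (q : R).
Local Notation gb := (gauss q).

Lemma gauss0 n : gb n 0 = 1. Proof. by case: n. Qed.

Lemma gaussS n k : gb n.+1 k.+1 = gb n k + q ^+ k.+1 * gb n k.+1.
Proof. by []. Qed.

Lemma gauss_small n k : (n < k)%N -> gb n k = 0.
Proof.
elim: n k => [|n IHn] [|k] //= ltnk.
by rewrite !IHn ?mulr0 ?addr0 // ltnW.
Qed.

Lemma gaussSr n k : (k <= n)%N ->
  gb n.+1 k.+1 = gb n k.+1 + q ^+ (n - k) * gb n k.
Proof.
elim: n k => [|n IHn] [|k] lekn //.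
- by rewrite /=; ring.
- rewrite [LHS]gaussS [in LHS](IHn 0%N) // [in RHS]gaussS !gauss0 !subn0 expr1 exprS; ring.
- have [ltkn|] := ltnP k n; last first.
    move=> lenk; have -> : k = n by lia.
    by rewrite gaussS subnn (gauss_small (ltnSn n.+1)); ring.
  rewrite [LHS]gaussS [in LHS](IHn k) // [in LHS](IHn k.+1) //.
  rewrite [gb n.+1 k.+2]gaussS [gb n.+1 k.+1]gaussS.
  rewrite subSS; set d := (n - k)%N.
  have -> : (n - k.+1)%N = d.-1 by rewrite /d; lia.
  have -> : d = d.-1.+1 by rewrite /d; lia.
  by rewrite /= !exprS; ring.
Qed.

Definition qnat (n : nat) : R := \sum_(i < n) q ^+ i.
Definition qfac (n : nat) : R := \prod_(1 <= j < n.+1) qnat j.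

Lemma qnatD m n : qnat (m + n) = qnat m + q ^+ m * qnat n.
Proof.
rewrite /qnat big_split_ord mulr_sumr /=; congr (_ + _).
by apply: eq_bigr => i _; rewrite exprD.
Qed.

Lemma qfacS n : qfac n.+1 = qfac n * qnat n.+1.
Proof. by rewrite /qfac big_nat_recr. Qed.

Lemma qfac0 : qfac 0 = 1.
Proof. by rewrite /qfac big_nil. Qed.

(** The q-Pascal rule matches the splitting of [qnat (k.+1 + l.+1)] by [qnatD]. *)
Lemma gauss_fac k l : gb (k + l) k * (qfac k * qfac l) = qfac (k + l).
Proof.
have [n] := ubnP (k + l)%N; elim: n k l => // n IHn [|k] [|l] ltkln.
- by rewrite /= qfac0 !mulr1.
- by rewrite gauss0 qfac0 !mul1r.
- have := IHn k 0%N; rewrite addn0 in ltkln *; rewrite addn0 => /(_ ltkln) IHk.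
  by rewrite gaussS (gauss_small (ltnSn k)) qfacS -[in RHS]IHk; ring.
- have IHk : gb (k + l.+1) k * (qfac k * qfac l.+1) = qfac (k + l.+1).
    by apply: IHn; lia.
  have IHl : gb (k + l.+1) k.+1 * (qfac k.+1 * qfac l) = qfac (k + l.+1).
    by rewrite -addSnnS; apply: IHn; lia.
  rewrite addSn gaussS [in RHS]qfacS -addSn qnatD mulrDr -{1}IHk -IHl.
  by rewrite (qfacS k) (qfacS l); ring.
Qed.

(* The complete homogeneous symmetric polynomial [h_k(1, q, ..., q^(n-1))]; the
   truncated predecessor gives the correct value 1 at [n = k = 0]. *)
Definition hsym (n k : nat) : R := gb (n + k).-1 k.

Lemma hsym0 n : hsym n 0 = 1. Proof. exact: gauss0. Qed.

Lemma hsym0S k : hsym 0 k.+1 = 0. Proof. exact: gauss_small. Qed.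

Lemma hsymSS n k : hsym n.+1 k.+1 = hsym n k.+1 + q ^+ n * hsym n.+1 k.
Proof. by rewrite /hsym !addSn !addnS -!pred_Sn gaussSr ?leq_addl // addnK. Qed.

End GaussianPolynomials.

(** * Separating even and odd powers of [q] *)

Section EvenOddSplit.
Variables (R : comNzRingType) (q : R).

(* [h_k] in the variables [1, q^2, ..., q^(2p-2)] and [q, q^3, ..., q^(2r-1)]. *)
Definition hsplit (p r k : nat) : R :=
  \sum_(j < k.+1) q ^+ (k - j) * hsym (q ^+ 2) p j * hsym (q ^+ 2) r (k - j).

Lemma hsplit0 p r : hsplit p r 0 = 1.
Proof. by rewrite /hsplit big_ord1 subnn !hsym0 !mulr1. Qed.

(** Adjoins the variable [q ^+ p.*2] to the even family; [hsplitSr] does the same for the odd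
    one. *)
Lemma hsplitSl p r k :
  hsplit p.+1 r k.+1 = hsplit p r k.+1 + q ^+ (p.*2) * hsplit p.+1 r k.
Proof.
rewrite /hsplit big_ord_recl [in RHS]big_ord_recl /= !hsym0 -addrA.
congr (_ + _); rewrite mulr_sumr -big_split /=; apply: eq_bigr => j _.
by rewrite /bump add1n subSS hsymSS -exprM -mul2n; ring.
Qed.

Lemma hsplitSr p r k :
  hsplit p r.+1 k.+1 = hsplit p r k.+1 + q ^+ r.*2.+1 * hsplit p r.+1 k.
Proof.
rewrite /hsplit big_ord_recr [in RHS]big_ord_recr /= subnn !hsym0.
rewrite [RHS]addrAC; congr (_ + _).
rewrite mulr_sumr -big_split /=; apply: eq_bigr => j _.
have lejk : (j <= k)%N by rewrite -ltnS.
by rewrite subSn // hsymSS -exprM mul2n !exprS; ring.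
Qed.

(** Even and odd powers are adjoined alternately, so each parity of the number of variables feeds
    the other. *)
Lemma hsym_split m k :
  hsym q m.*2 k = hsplit m m k /\ hsym q m.*2.+1 k = hsplit m.+1 m k.
Proof.
have odd_of_even n : (forall l, hsym q n.*2 l = hsplit n n l) ->
    forall l, hsym q n.*2.+1 l = hsplit n.+1 n l.
  move=> even_n; elim=> [|l IHl]; first by rewrite hsym0 hsplit0.
  by rewrite hsymSS hsplitSl IHl even_n.
suff even_m l : hsym q m.*2 l = hsplit m m l by split; last exact: odd_of_even.
elim: m l => [|m IHm].
  case=> [|l]; first by rewrite hsym0 hsplit0.
  rewrite hsym0S /hsplit big1 // => -[[|j] ltj] _ /=.
    by rewrite subn0 hsym0S mulr0.
  by rewrite hsym0S mulr0 mul0r.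
elim=> [|l IHl]; first by rewrite hsym0 hsplit0.
by rewrite doubleS hsymSS hsplitSr -doubleS IHl odd_of_even.
Qed.

End EvenOddSplit.

(** * Symmetry and trinomial revision, by cancelling q-factorials *)

Section Revision.
Variables (R : idomainType) (q : R).
Hypothesis qnat_neq0 : forall n, qnat q n.+1 != 0.
Local Notation gb := (gauss q).

Lemma qfac_neq0 n : qfac q n != 0.
Proof.
by elim: n => [|n IHn]; rewrite ?qfac0 ?oner_eq0 // qfacS mulf_neq0.
Qed.

Lemma gauss_sym k l : gb (k + l) k = gb (k + l) l.
Proof.
have fac_neq0 : qfac q k * qfac q l != 0 by rewrite mulf_neq0 ?qfac_neq0.
apply: (mulIf fac_neq0); rewrite gauss_fac.
by rewrite addnC [qfac q k * _]mulrC gauss_fac.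
Qed.

(** Both sides are the q-multinomial coefficient with parts [r], [b], [c]. *)
Lemma gauss_trinomial r b c :
  gb (r + b + c) (r + b) * gb (r + b) r = gb (r + b + c) r * gb (b + c) b.
Proof.
have fac_neq0 : qfac q r * qfac q b * qfac q c * qfac q (r + b) * qfac q (b + c) != 0.
  by rewrite !mulf_neq0 ?qfac_neq0.
apply: (mulIf fac_neq0).
transitivity ((gb (r + b + c) (r + b) * (qfac q (r + b) * qfac q c)) *
              (gb (r + b) r * (qfac q r * qfac q b)) * qfac q (b + c)); first by ring.
rewrite !gauss_fac.
transitivity ((gb (r + (b + c)) r * (qfac q r * qfac q (b + c))) *
              (gb (b + c) b * (qfac q b * qfac q c)) * qfac q (r + b)).
  by rewrite !gauss_fac addnA; ring.
by rewrite addnA; ring.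
Qed.

End Revision.

(** * Closure properties of coefficientwise nonnegativity *)

Lemma nonneg0 : nonneg_coeffs 0.
Proof. by move=> i; rewrite coef0. Qed.

Lemma nonneg1 : nonneg_coeffs 1.
Proof. by move=> i; rewrite coef1 ler0n. Qed.

Lemma nonnegX : nonneg_coeffs 'X.
Proof. by move=> i; rewrite coefX ler0n. Qed.

Lemma nonnegD p r : nonneg_coeffs p -> nonneg_coeffs r -> nonneg_coeffs (p + r).
Proof. by move=> hp hr i; rewrite coefD addr_ge0. Qed.

Lemma nonnegM p r : nonneg_coeffs p -> nonneg_coeffs r -> nonneg_coeffs (p * r).
Proof. by move=> hp hr i; rewrite coefM sumr_ge0 // => j _; rewrite mulr_ge0. Qed.

Lemma nonnegE p n : nonneg_coeffs p -> nonneg_coeffs (p ^+ n).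
Proof.
move=> hp; elim: n => [|n IHn]; first exact: nonneg1.
by rewrite exprS; apply: nonnegM.
Qed.

Lemma nonneg_sum n (F : 'I_n -> {poly rat}) :
  (forall i, nonneg_coeffs (F i)) -> nonneg_coeffs (\sum_i F i).
Proof. by move=> hF i; rewrite coef_sum sumr_ge0 // => j _; apply: hF. Qed.

(** * Coefficientwise inequalities *)

Section Positivity.
Variable q : {poly rat}.
Hypothesis q_ge0 : nonneg_coeffs q.
Local Notation gb := (gauss q).

Lemma nonneg_gauss n k : nonneg_coeffs (gb n k).
Proof.
elim: n k => [|n IHn] [|k] /=; [exact: nonneg1|exact: nonneg0|exact: nonneg1|].
by apply: nonnegD => //; apply: nonnegM => //; apply: nonnegE.
Qed.

(** The constant coefficient is 1 plus a nonnegative number. *)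
Lemma qnat_neq0 n : qnat q n.+1 != 0.
Proof.
apply/eqP => /(congr1 (fun p : {poly rat} => p`_0)).
rewrite /qnat big_ord_recl expr0 coefD coef1 coef0 /= => /eqP.
rewrite gt_eqF // ltr_pwDl //.
by apply: nonneg_sum => i; apply: nonnegE.
Qed.

(* The twist by [q ^+ c] is what makes the induction on [n] close. *)
Lemma gauss_step n k c : (c + k.*2.+1 <= n)%N ->
  nonneg_coeffs (gb n k.+1 - q ^+ c * gb n k).
Proof.
elim: n k c => [|n IHn] k c le_ckn; first by lia.
have [c0|c_gt0] := posnP c.
  rewrite c0 expr0 mul1r in le_ckn *.
  (* In the middle, [k] and [k.+1] are complementary lower indices and the difference vanishes. *)
  have [nk|nk] := eqVneq n k.*2.
    have -> : n.+1 = (k.+1 + k)%N by lia.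
    by rewrite (gauss_sym qnat_neq0) subrr; apply: nonneg0.
  case: k le_ckn nk => [|k] le_ckn nk.
    rewrite gaussSr // !gauss0 mulr1 -[_ - 1]addrA.
    have := IHn 0%N 0%N; rewrite gauss0 expr0 mul1r => IH.
    rewrite addrCA; apply: nonnegD; first exact: nonnegE.
    by apply: IH; lia.
  (* This form of the Pascal rule produces differences with twists 0 and 1. *)
  rewrite (@gaussSr _ q n k.+1) ?(@gaussSr _ q n k); [|lia|lia].
  have -> : (n - k)%N = (n - k.+1).+1 by lia.
  have -> : gb n k.+2 + q ^+ (n - k.+1) * gb n k.+1 -
      (gb n k.+1 + q ^+ (n - k.+1).+1 * gb n k) =
      (gb n k.+2 - q ^+ 0 * gb n k.+1) +
      q ^+ (n - k.+1) * (gb n k.+1 - q ^+ 1 * gb n k).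
    by rewrite exprS expr0 expr1; ring.
  apply: nonnegD; first by apply: IHn; lia.
  by apply: nonnegM; [apply: nonnegE | apply: IHn; lia].
case: c c_gt0 le_ckn => // c _ le_ckn.
case: k le_ckn => [|k] le_ckn.
  have -> : gb n.+1 1 - q ^+ c.+1 * gb n.+1 0 =
      1 + q * (gb n 1 - q ^+ c * gb n 0).
    by rewrite gaussS !gauss0 expr1 exprS; ring.
  apply: nonnegD; first exact: nonneg1.
  by apply: nonnegM => //; apply: IHn; lia.
(* For a positive twist the defining recurrence is used instead: it lowers the twist by one, or
   keeps it and lowers [k]. *)
have -> : gb n.+1 k.+2 - q ^+ c.+1 * gb n.+1 k.+1 =
    q ^+ k.+2 * (gb n k.+2 - q ^+ c * gb n k.+1) +
    (gb n k.+1 - q ^+ c.+1 * gb n k).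
  by rewrite !gaussS !exprS; ring.
apply: nonnegD; last by apply: IHn; lia.
by apply: nonnegM; [apply: nonnegE | apply: IHn; lia].
Qed.

(** Up to the middle, [gauss_step] with twist 0 telescopes; beyond it, [k] is reflected to
    [n - k]. *)
Lemma gauss_unimodal n l k : (l <= k)%N -> (k + l <= n)%N ->
  nonneg_coeffs (gb n k - gb n l).
Proof.
have half d j : ((j + d).*2 <= n)%N -> nonneg_coeffs (gb n (j + d) - gb n j).
  elim: d => [|d IHd] le_n; first by rewrite addn0 subrr; apply: nonneg0.
  rewrite -(subrKA (gb n (j + d))) addnS; apply: nonnegD; last by apply: IHd; lia.
  have := @gauss_step n (j + d) 0; rewrite expr0 mul1r; apply; lia.
move=> lelk lekln; have [le_kn|lt_nk] := leqP k.*2 n.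
  by have := half (k - l)%N l; rewrite subnKC //; apply.
have -> : gb n k = gb n (n - k).
  by have := gauss_sym qnat_neq0 k (n - k); rewrite subnKC //; lia.
have := half (n - k - l)%N l; rewrite subnKC; last by lia.
by apply; lia.
Qed.

(* The exact coefficients are irrelevant: it matters only that they are
   nonnegative and do not depend on [x]. *)
Lemma gauss_Vandermonde y s : exists2 c : nat -> {poly rat},
  (forall r, nonneg_coeffs (c r)) &
  (forall x, gb (x + y) s = \sum_(r < s.+1) c r * gb x r).
Proof.
elim: y s => [|y IHy] s.
  exists (fun r => (r == s)%:R) => [r|x].
    by case: eqP => _; [exact: nonneg1 | exact: nonneg0].
  rewrite addn0 big_ord_recr /= eqxx mul1r big1 ?add0r // => r _.
  by rewrite ltn_eqF ?mul0r.
case: s => [|s].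
  exists (fun=> 1) => [_|x]; first exact: nonneg1.
  by rewrite big_ord1 !gauss0 mulr1.
have [c1 c1_ge0 c1E] := IHy s; have [c2 c2_ge0 c2E] := IHy s.+1.
(* The guard extends the expansion of order [s] by a zero term at [r = s.+1]. *)
exists (fun r => (if (r <= s)%N then c1 r else 0) + q ^+ s.+1 * c2 r) => [r|x].
  apply: nonnegD; first by case: ifP => _ //; apply: nonneg0.
  by apply: nonnegM => //; apply: nonnegE.
rewrite addnS gaussS c1E c2E mulr_sumr.
under [RHS]eq_bigr => r _ do rewrite mulrDl -mulrA.
rewrite big_split /=; congr (_ + _).
rewrite [RHS]big_ord_recr /= ltnn mul0r addr0.
by apply: eq_bigr => r _; rewrite -ltnS ltn_ord.
Qed.

Lemma gauss_product_le m j s y : (j + s <= m)%N ->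
  nonneg_coeffs (gb (m + j) (j + s) * gb (j + s + y) s
                 - gb (m + j) j * gb (m + y) s).
Proof.
move=> le_jsm; have [c c_ge0 cE] := gauss_Vandermonde y s.
rewrite !cE !mulr_sumr -sumrB; apply: nonneg_sum => -[r /= lt_rs].
have -> : gb (m + j) (j + s) * (c r * gb (j + s) r) -
    gb (m + j) j * (c r * gb m r) =
    c r * (gb (m + j) (j + s) * gb (j + s) r - gb (m + j) j * gb m r) by ring.
apply: nonnegM => //.
have := gauss_trinomial qnat_neq0 r (j + s - r) (m - s).
have := gauss_trinomial qnat_neq0 r (m - r) j.
have -> : (r + (m - r))%N = m by lia.
have -> : (r + (j + s - r))%N = (j + s)%N by lia.
have -> : (j + s + (m - s))%N = (m + j)%N by lia.
have -> : (j + s - r + (m - s))%N = (m - r + j)%N by lia.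
(* The common factor [gb (m + j) r] comes out, leaving lower indices [j + s - r] and [j] over
   [m - r + j]. *)
rewrite !(gauss_sym qnat_neq0 _ j) => -> ->; rewrite -mulrBr.
by apply: nonnegM; [exact: nonneg_gauss | apply: gauss_unimodal; lia].
Qed.

End Positivity.

(** * Transfer to [qbinom] and conclusion *)

Lemma qbinom_gauss k l : qbinom (k + l) k = gauss 'X (k + l) k.
Proof.
rewrite /qbinom leq_addr addKn -[qfact (k + l)]/(qfac 'X (k + l)) -gauss_fac.
have neq0 n := qfac_neq0 (qnat_neq0 nonnegX) n.
by rewrite mulpK // mulf_neq0 //; apply: neq0.
Qed.

Theorem theorem3 (a i : nat) (ha : (0 < a)%N) (hi : (0 < i)%N) :
  nonneg_coeffs (qbinom (3 * a + i) (a + i) - qbinom (3 * a + 2 * i) a)%R.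
Proof.
set m := (a + i)%N.
have -> : (3 * a + i)%N = (m + a.*2)%N by lia.
have -> : (3 * a + 2 * i)%N = (a + m.*2)%N by lia.
rewrite !qbinom_gauss.
have hsymE x n : gauss 'X (x + n.*2) x = hsym ('X : {poly rat}) n.*2.+1 x.
  by rewrite /hsym addSn addnC.
rewrite !hsymE !(proj2 (hsym_split _ _ _)) /hsplit.
(* Term [i + j] of the first sum carries the same power [a - j] of ['X] as term [j] of the second;
   the first [i] terms are a nonnegative surplus. *)
have mE : m.+1 = (i + a.+1)%N by rewrite /m; lia.
rewrite [in X in X - _]mE big_split_ord /= -addrA -sumrB.
set Q : {poly rat} := 'X ^+ 2.
have Q_ge0 : nonneg_coeffs Q by apply: nonnegE; exact: nonnegX.
have ge0 n k : nonneg_coeffs (hsym Q n k) by apply: nonneg_gauss.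
apply: nonnegD; apply: nonneg_sum; first move=> j.
  by do 2!apply: nonnegM => //; apply: nonnegE; exact: nonnegX.
move=> [j /= lt_ja].
have -> : (m - (i + j))%N = (a - j)%N by rewrite /m; lia.
rewrite -!mulrA -mulrBr; apply: nonnegM; first by apply: nonnegE; exact: nonnegX.
(* With the predecessor on [k], also valid at [k = 0], both second factors share the excess
   [(a - j).-1], which becomes [y] in [gauss_product_le]. *)
have hsym_pred n k : hsym Q n k = gauss Q (n + k.-1) k.
  by case: k => [|k]; rewrite ?hsym0 ?gauss0 // /hsym addnS.
rewrite !(hsym_pred _ (a - j)%N) /hsym !addSn /=.
have := gauss_sym (qnat_neq0 Q_ge0) (i + j) a.
have -> : (i + j + a)%N = (m + j)%N by rewrite /m; lia.
have -> : (a + (i + j))%N = (m + j)%N by rewrite /m; lia.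
move=> ->; have := @gauss_product_le Q Q_ge0 m j (a - j) (a - j).-1.
by rewrite subnKC //; apply; rewrite /m; lia.
Qed.
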